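(* Let $X$ be a real normed space, let $C\subseteq X$ be a convex set, let $h:C\rightarrow\mathbb{R}$ be a function, and let $\gamma>0$. If $h$ is strongly quasiconvex with modulus $\gamma$, then for every $x,y\in C$ and every $z=x+t(y-x)$ with $0<t\leq 1$, the following implication holds: $$h(x)\leq h(z)\ \Longrightarrow\ h(z)\leq h(y)-\frac{\gamma}{4}(1-t^{2})\lVert y-x\rVert^{2}=h(y)-\frac{\gamma}{4}\left(\lVert y-x\rVert^{2}-\lVert z-x\rVert^{2}\right).\qquad (\ast)$$ Conversely, if $h$ is continuous along line segments of $C$, and the implication $(\ast)$ holds for every $x,y\in C$ and every $z=x+t(y-x)$ with $0<t\leq 1$, then $h$ is strongly quasiconvex with modulus $\frac{\gamma}{2}$.
   Context: A function $h:C\to\mathbb{R}$ on a convex subset $C$ of a normed space $X$ is called strongly quasiconvex with modulus $\gamma>0$ if for every $x,y\in C$ and every $t\in[0,1]$, $$h(x+t(y-x))\leq\max\{h(x),h(y)\}-\frac{\gamma}{2}t(1-t)\lVert y-x\rVert^{2}.$$ ''Continuous along line segments of $C$'' means that for all $x,y\in C$ the restriction of $h$ to the segment $[x,y]$ is continuous, i.e. $t\mapsto h(x+t(y-x))$ is continuous on $[0,1]$. *)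

(* Defs.v *)
From HB Require Import structures.
From mathcomp Require Import all_boot all_order all_algebra.
From mathcomp Require Import all_classical all_reals all_analysis.

Set Implicit Arguments.
Unset Strict Implicit.
Unset Printing Implicit Defensive.

Import Order.TTheory GRing.Theory Num.Theory.
Import numFieldNormedType.Exports.

Local Open Scope classical_set_scope.
Local Open Scope ring_scope.

(* A function C -> R is represented by a total h : X -> R; the definitions
   below, used with C convex, only ever inspect h at points of C. *)

Definition strongly_quasiconvex (R : realType) (X : normedModType R)
    (C : set X) (h : X -> R) (gamma : R) : Prop :=
  0 < gamma /\
  forall x y : X, C x -> C y -> forall t : R, 0 <= t <= 1 ->
    h (x + t *: (y - x)) <=
      Num.max (h x) (h y) - gamma / 2 * t * (1 - t) * `|y - x| ^+ 2.

Definition continuous_along_segments (R : realType) (X : normedModType R)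
    (C : set X) (h : X -> R) : Prop :=
  forall x y : X, C x -> C y ->
    {within `[0 : R, 1 : R], continuous (fun t : R => h (x + t *: (y - x)))}.

Definition quadratic_growth_implication (R : realType) (X : normedModType R)
    (h : X -> R) (gamma : R) (x y z : X) (t : R) : Prop :=
  h x <= h z ->
    h z <= h y - gamma / 4 * (1 - t ^+ 2) * `|y - x| ^+ 2 /\
    h y - gamma / 4 * (1 - t ^+ 2) * `|y - x| ^+ 2 =
      h y - gamma / 4 * (`|y - x| ^+ 2 - `|z - x| ^+ 2).

(* Main.v *)
Require Import Defs.
From HB Require Import structures.
From mathcomp Require Import all_boot all_order all_algebra.
From mathcomp Require Import all_classical all_reals all_analysis.
From mathcomp Require Import ring lra.

Import Order.TTheory GRing.Theory Num.Theory.
Import numFieldNormedType.Exports.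

Local Open Scope classical_set_scope.
Local Open Scope ring_scope.

(** Everything happens on one segment: put [phi s := h (x + s *: (y - x))] and
    absorb [`|y - x| ^+ 2] in a constant [k], so that both properties become
    statements about a real function on [0, 1].

    Direct implication, [phi 0 <= phi t].  Strong quasiconvexity between the
    points 0 and [s] forces [phi r <= phi s - k * r * (s - r)] for
    [t <= r <= s <= 1].  Used once, between [t] and 1, this only gives the
    constant [k * t * (1 - t)]; summed over ever finer subdivisions of [t, 1] it
    becomes the integral of [k * r], that is [k / 2 * (1 - t ^+ 2)].  The
    summation is replaced by the remark that [phi r - k / 2 * r ^+ 2] decreases
    by at most a multiple of [(s - r) ^+ 2] between [r] and [s], hence not at
    all ([le_of_quadratic_defect]).

    Converse, for an interior [t].  If [phi t] is at least one of the end values,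
    the growth inequality based at that end is more than enough.  Otherwise there
    are two possibilities.  Either [phi t] is the minimum of [phi], and the
    inequality based at [t] and read at points tending to [t] bounds [phi t] by
    both end values ([minimum_bound]).  Or [phi] is smaller somewhere, and by the
    intermediate value theorem [phi] takes the value [phi t] at some [u != t];
    of the two growth inequalities, from the left one of [t], [u] towards 1 and
    from the right one towards 0, one always suffices ([level_pair_bound]). *)

(** Halving the interval replaces [K] by [K / 2], since the squares of the two
    half-lengths add up to half the square of the length; iterating, the
    possible decrease of [G] is below every [K / 2 ^+ n]. *)
Lemma le_of_quadratic_defect {R : realType} (G : R -> R) (K : R) {a b : R} :
  (forall r s, a <= r -> r <= s -> s <= b -> G r - G s <= K * (s - r) ^+ 2) ->
  a <= b -> G a <= G b.
Proof.
move=> H ab.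
have halving n : forall r s, a <= r -> r <= s -> s <= b ->
    2 ^+ n * (G r - G s) <= K * (s - r) ^+ 2.
  elim: n => [|n IH] r s ar rs sb; first by rewrite expr0 mul1r; exact: H.
  have h1 := IH r ((r + s) / 2) ar ltac:(lra) ltac:(lra).
  have h2 := IH ((r + s) / 2) s ltac:(lra) ltac:(lra) sb.
  rewrite exprS; move: (2 ^+ n) h1 h2 => p h1 h2.
  have e : K * (s - r) ^+ 2 = 2 * (K * ((r + s) / 2 - r) ^+ 2 +
    K * (s - (r + s) / 2) ^+ 2) by field.
  rewrite e; lra.
rewrite leNgt; apply/negP => Gba.
have e0 : 0 < G a - G b by rewrite subr_gt0.
have := halving _ a b (lexx a) ab (lexx b).
move=> /(_ (Num.bound (K * (b - a) ^+ 2 / (G a - G b)))).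
by rewrite -ler_pdivlMr// leNgt upper_nthrootP.
Qed.

(** Only the pairs [(0, s)] matter: as [phi 0 <= phi r], the maximum of [phi 0]
    and [phi s] in the quasiconvexity inequality at [r] has to be [phi s],
    because a positive quantity is subtracted from it.  This is why [k] must be
    positive here: for [k = 0] a function that is constant before 1 and drops at
    1 is a counterexample. *)
Lemma strong_quasiconvexity_growth {R : realType} {phi : R -> R} {k t : R} :
  0 < k -> 0 < t -> t <= 1 ->
  (forall s l, 0 <= s <= 1 -> 0 <= l <= 1 ->
    phi (l * s) <= Num.max (phi 0) (phi s) - k * l * (1 - l) * s ^+ 2) ->
  phi 0 <= phi t -> phi t <= phi 1 - k / 2 * (1 - t ^+ 2).
Proof.
move=> k0 t0 t1 H ht.
have step r s : 0 < r -> r <= s -> s <= 1 -> phi 0 <= phi r ->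
    phi r <= phi s - k * r * (s - r).
  move=> r0; rewrite le_eqVlt => /predU1P[<- _ _|rs s1 hr]; first by lra.
  have s0 : 0 < s by lra.
  have rs01 : 0 <= r / s <= 1.
    by rewrite ler_pdivrMr// mul1r (ltW rs) andbT divr_ge0// ltW.
  have := H s (r / s) ltac:(lra) rs01.
  rewrite divfK ?gt_eqF//.
  have -> : k * (r / s) * (1 - r / s) * s ^+ 2 = k * r * (s - r).
    by field; rewrite gt_eqF.
  have : 0 < k * r * (s - r) by rewrite !mulr_gt0// subr_gt0.
  by case: (leP (phi 0) (phi s)) => ? ? ?; lra.
suff : phi t - k / 2 * t ^+ 2 <= phi 1 - k / 2 * 1 ^+ 2 by lra.
apply: (le_of_quadratic_defect (fun r => phi r - k / 2 * r ^+ 2) (k / 2)) => //.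
move=> r s tr rs s1.
(* [phi] does not decrease from [t] to [r], so the assumption at [t] passes to [r]. *)
have hr : phi 0 <= phi r.
  have := step t r t0 tr ltac:(lra) ht.
  have : 0 <= k * t * (r - t) by rewrite !mulr_ge0 ?subr_ge0// ltW.
  lra.
have := step r s ltac:(lra) rs s1 hr.
have : k / 2 * (s - r) ^+ 2 = k / 2 * (s ^+ 2 - r ^+ 2) - k * r * (s - r) by field.
lra.
Qed.

Definition unit_interval_growth {R : realType} (phi : R -> R) (k : R) : Prop :=
  forall a b l, 0 <= a <= 1 -> 0 <= b <= 1 -> 0 < l <= 1 ->
  phi a <= phi (a + l * (b - a)) ->
  phi (a + l * (b - a)) <= phi b - k * (1 - l ^+ 2) * (b - a) ^+ 2.

(** The same inequality indexed by the intermediate point [s] instead of its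
    ratio [l], on either side of the base point [a]. *)
Lemma growth_between {R : realType} {phi : R -> R} {k : R} (a b s : R)
    (H : unit_interval_growth phi k) : 0 <= a <= 1 -> 0 <= b <= 1 ->
  a < s <= b \/ b <= s < a -> phi a <= phi s ->
  phi s <= phi b - k * ((b - a) ^+ 2 - (s - a) ^+ 2).
Proof.
move=> a01 b01 sab.
have ba : b - a != 0.
  by apply/eqP => ba; case: sab => ?; lra.
have l01 : 0 < (s - a) / (b - a) <= 1.
  case: sab => sab; last rewrite -(opprB a s) -(opprB a b) invrN mulrNN.
    rewrite divr_gt0 ?ler_pdivrMr; lra.
  rewrite divr_gt0 ?ler_pdivrMr; lra.
have := H a b _ a01 b01 l01; rewrite divfK// subrKC => /[apply].
congr (_ <= _ - _); field.
exact: ba.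
Qed.

(** Since [phi p = phi q], the growth inequality applies both with base [p] and
    intermediate point [q] towards 1, and with base [q] and intermediate point
    [p] towards 0.  They give the constants [(1 - q) * (1 + q - 2 * p)] and
    [p * (2 * q - p)]; which of them exceeds [t * (1 - t)] depends on the
    position of [p] and [q] with respect to 1/2. *)
Lemma level_pair_bound {R : realType} {phi : R -> R} {k : R} (p q t : R)
    (k0 : 0 <= k) (H : unit_interval_growth phi k) :
  0 <= p -> p < q -> q <= 1 -> phi p = phi q ->
  t = p \/ t = q ->
  phi t <= Num.max (phi 0) (phi 1) - k * t * (1 - t).
Proof.
move=> p0 pq q1 e tpq.
have h1 := growth_between p 1 q H ltac:(lra) ltac:(lra) ltac:(lra) ltac:(lra).
have h0 := growth_between q 0 p H ltac:(lra) ltac:(lra) ltac:(lra) ltac:(lra).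
suff : k * t * (1 - t) <= k * ((1 - p) ^+ 2 - (q - p) ^+ 2) \/
       k * t * (1 - t) <= k * ((0 - q) ^+ 2 - (p - q) ^+ 2).
  have : phi 0 <= Num.max (phi 0) (phi 1) by rewrite le_max lexx.
  have : phi 1 <= Num.max (phi 0) (phi 1) by rewrite le_max lexx orbT.
  have : phi t = phi q by case: tpq => ->.
  by move=> ? ? ? [] ?; lra.
rewrite -!mulrA; case: (leP p 2^-1) => hp; case: (leP q 2^-1) => hq;
  case: tpq => ->;
  first [left; apply: ler_wpM2l => //; nra | right; apply: ler_wpM2l => //; nra].
Qed.

(** The growth inequality based at the minimiser [t] is available at every
    nearby point [s] on either side; as [phi t <= phi s], letting [s] tend to
    [t] yields both [phi t <= phi 1 - k * (1 - t) ^+ 2] and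
    [phi t <= phi 0 - k * t ^+ 2], and one of the two squares is at least
    [t * (1 - t)]. *)
Lemma minimum_bound {R : realType} {phi : R -> R} {k : R} (t : R)
    (k0 : 0 <= k) (H : unit_interval_growth phi k) :
  0 < t < 1 -> (forall s, 0 <= s <= 1 -> phi t <= phi s) ->
  phi t <= Num.max (phi 0) (phi 1) - k * t * (1 - t).
Proof.
move=> t01 tmin.
have small (e : R) : 0 < e ->
    exists2 d, [/\ 0 < d, d <= t & d <= 1 - t] & k * d ^+ 2 <= e.
  move=> e0; have k1 : 0 < k + 1 by lra.
  (* As [d <= 1], [k * d ^+ 2 <= k * d]; the [+ 1] avoids dividing by [k = 0]. *)
  pose d := Num.min (Num.min t (1 - t)) (e / (k + 1)).
  have [d_le d_e] : d <= Num.min t (1 - t) /\ d <= e / (k + 1).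
    by split; rewrite /d ge_min lexx ?orbT.
  have d0 : 0 < d by rewrite /d !lt_min divr_gt0// andbT; lra.
  move: d_le; rewrite le_min => /andP[dt d1t]; exists d => //.
  rewrite ler_pdivlMr// in d_e.
  have : k * d * d <= k * d * 1.
    by apply: ler_wpM2l; [rewrite mulr_ge0// ltW | lra].
  by rewrite -mulrA -expr2; lra.
have right_ : phi t <= phi 1 - k * (1 - t) ^+ 2.
  apply/ler_addgt0Pr => e /small[d [d0 dt d1t] kd].
  have ts := tmin (t + d) ltac:(lra).
  have := growth_between t 1 (t + d) H ltac:(lra) ltac:(lra) ltac:(lra) ts.
  by rewrite addrAC subrr add0r; lra.
have left_ : phi t <= phi 0 - k * t ^+ 2.
  apply/ler_addgt0Pr => e /small[d [d0 dt d1t] kd].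
  have ts := tmin (t - d) ltac:(lra).
  have := growth_between t 0 (t - d) H ltac:(lra) ltac:(lra) ltac:(lra) ts.
  by rewrite addrAC subrr !add0r !sqrrN; lra.
have : phi 0 <= Num.max (phi 0) (phi 1) by rewrite le_max lexx.
have : phi 1 <= Num.max (phi 0) (phi 1) by rewrite le_max lexx orbT.
case: (leP t 2^-1) => ht.
  suff : k * t * (1 - t) <= k * (1 - t) ^+ 2 by lra.
  by rewrite -mulrA ler_wpM2l//; nra.
suff : k * t * (1 - t) <= k * t ^+ 2 by lra.
by rewrite -mulrA ler_wpM2l//; nra.
Qed.

Lemma unit_interval_growth_bound {R : realType} {phi : R -> R} {k : R} (t : R)
    (k0 : 0 <= k) (H : unit_interval_growth phi k) :
  {within `[0, 1], continuous phi} -> 0 <= t <= 1 ->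
  phi t <= Num.max (phi 0) (phi 1) - k * t * (1 - t).
Proof.
move=> cphi t01.
have max0 : phi 0 <= Num.max (phi 0) (phi 1) by rewrite le_max lexx.
have max1 : phi 1 <= Num.max (phi 0) (phi 1) by rewrite le_max lexx orbT.
have [-> |tn0] := eqVneq t 0; first by lra.
have [-> |tn1] := eqVneq t 1; first by lra.
have t01' : 0 < t < 1 by rewrite !lt_neqAle eq_sym tn0 tn1.
have [h0|h0] := leP (phi 0) (phi t).
  have := growth_between 0 1 t H ltac:(lra) ltac:(lra) ltac:(lra) h0.
  suff : k * t * (1 - t) <= k * ((1 - 0) ^+ 2 - (t - 0) ^+ 2) by lra.
  by rewrite -mulrA ler_wpM2l//; nra.
have [h1|h1] := leP (phi 1) (phi t).
  have := growth_between 1 0 t H ltac:(lra) ltac:(lra) ltac:(lra) h1.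
  suff : k * t * (1 - t) <= k * ((0 - 1) ^+ 2 - (t - 1) ^+ 2) by lra.
  by rewrite -mulrA ler_wpM2l//; nra.
have [[s s01 st]|tmin] := pselect (exists2 s, 0 <= s <= 1 & phi s < phi t); last first.
  apply: minimum_bound => // s s01; rewrite leNgt; apply/negP => st.
  by apply: tmin; exists s.
case/andP: (s01) => s0 s1.
have [ts|ts] := leP t s.
  have cs : {within `[s, 1], continuous phi}.
    by apply: continuous_subspaceW cphi => r /=; rewrite !in_itv/=; lra.
  have [|u] := IVT (v := phi t) s1 cs.
    by rewrite ge_min le_max (ltW st) (ltW h1) orbT.
  rewrite in_itv/= => /andP[su u1] ut.
  have ts' : t < s.
    by rewrite lt_neqAle ts andbT; apply/eqP => e; move: st; rewrite e ltxx.
  by apply: (level_pair_bound t u) => //; [lra|lra|left].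
have cs : {within `[0, s], continuous phi}.
  by apply: continuous_subspaceW cphi => r /=; rewrite !in_itv/=; lra.
have [|u] := IVT (v := phi t) s0 cs.
  by rewrite ge_min le_max (ltW st) (ltW h0) orbT.
rewrite in_itv/= => /andP[u0 us] ut.
by apply: (level_pair_bound u t) => //; [lra|lra|right].
Qed.

Lemma convex_segment {R : realType} {X : normedModType R} {C : set X} {x y : X}
    {t : R} : convex_set C -> C x -> C y -> 0 <= t <= 1 -> C (x + t *: (y - x)).
Proof.
move=> hC Cx Cy /andP[t0 t1].
have := hC y x (Itv01 t0 t1) (mem_set Cy) (mem_set Cx).
move/set_mem; congr (C _).
change (t *: y + (1 - t) *: x = x + t *: (y - x)).
by rewrite scalerBl scale1r scalerBr addrCA.
Qed.

(** Subsegments of a segment are affine reparametrisations of it: this carries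
    the inequalities assumed for pairs of points of [C] over to [phi]. *)
Lemma segment_reparam {R : realType} {X : normedModType R} (x y : X) (a b l : R) :
  x + (a + l * (b - a)) *: (y - x) =
  x + a *: (y - x) + l *: (x + b *: (y - x) - (x + a *: (y - x))).
Proof.
by rewrite opprD addrACA subrr add0r -scalerBl scalerA scalerDl addrA.
Qed.

Lemma segment_dist {R : realType} {X : normedModType R} (x y : X) (a b : R) :
  `|x + b *: (y - x) - (x + a *: (y - x))| ^+ 2 = (b - a) ^+ 2 * `|y - x| ^+ 2.
Proof.
by rewrite opprD addrACA subrr add0r -scalerBl normrZ exprMn real_normK ?num_real.
Qed.

Theorem theorem4 (R : realType) (X : normedModType R) (C : set X)
    (h : X -> R) (gamma : R) (hC : convex_set C) (hgamma : 0 < gamma) :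
  (strongly_quasiconvex C h gamma ->
    forall x y z : X, forall t : R, C x -> C y -> 0 < t <= 1 ->
      z = x + t *: (y - x) -> quadratic_growth_implication h gamma x y z t) /\
  (continuous_along_segments C h ->
    (forall x y z : X, forall t : R, C x -> C y -> 0 < t <= 1 ->
      z = x + t *: (y - x) -> quadratic_growth_implication h gamma x y z t) ->
    strongly_quasiconvex C h (gamma / 2)).
Proof.
split=> [[_ sqc] x y z t Cx Cy /andP[t0 t1] ->|hcont growth].
  rewrite /quadratic_growth_implication => hxz; split; last first.
    by rewrite addrAC subrr add0r normrZ exprMn real_normK ?num_real//; ring.
  (* A degenerate segment makes [k] vanish, but then [phi] is constant. *)
  have [xy|xy] := eqVneq x y.
    by move: hxz; rewrite -xy subrr scaler0 addr0 normr0; lra.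
  pose phi s := h (x + s *: (y - x)).
  have phi0 : phi 0 = h x by rewrite /phi scale0r addr0.
  have phi1 : phi 1 = h y by rewrite /phi scale1r subrKC.
  have d0 : 0 < `|y - x| ^+ 2 by rewrite exprn_gt0// normr_gt0 subr_eq0 eq_sym.
  have := @strong_quasiconvexity_growth _ phi (gamma / 2 * `|y - x| ^+ 2) t.
  rewrite phi0 phi1 => /(_ _ t0 t1 _ hxz).
  have -> : gamma / 4 * (1 - t ^+ 2) * `|y - x| ^+ 2 =
    gamma / 2 * `|y - x| ^+ 2 / 2 * (1 - t ^+ 2) by field.
  apply; first by rewrite mulr_gt0// divr_gt0.
  move=> s l s01 l01.
  have := sqc _ _ Cx (convex_segment hC Cx Cy s01) l l01.
  have := segment_reparam x y 0 s l; have := segment_dist x y 0 s.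
  rewrite scale0r addr0 subr0 add0r => -> <-.
  by rewrite /phi; congr (_ <= _ - _); ring.
split; first by rewrite divr_gt0.
move=> x y Cx Cy t t01.
pose phi s := h (x + s *: (y - x)).
have phi0 : phi 0 = h x by rewrite /phi scale0r addr0.
have phi1 : phi 1 = h y by rewrite /phi scale1r subrKC.
have -> : gamma / 2 / 2 * t * (1 - t) * `|y - x| ^+ 2 =
  (gamma / 4 * `|y - x| ^+ 2) * t * (1 - t) by field.
rewrite -phi0 -phi1; apply: unit_interval_growth_bound => //.
- by rewrite mulr_ge0 ?exprn_ge0// divr_ge0// ltW.
- move=> a b l a01 b01 l01 hab.
  have Ca := convex_segment hC Cx Cy a01.
  have Cb := convex_segment hC Cx Cy b01.
  have /(_ _)[] := growth _ _ _ l Ca Cb l01 (segment_reparam x y a b l) => //.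
  rewrite segment_dist => + _; congr (_ <= _ - _); ring.
- exact: hcont.
Qed.
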